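(* Let $R$ be a finite ring, let $R^{ss}=R/\mathrm{Rad}(R)\cong \mathbb{F}_2^r\times R_0$ be the decomposition in which $r$ is the number of Artin–Wedderburn factors of $R^{ss}$ isomorphic to $\mathbb{F}_2$ and $R_0$ is the product of the remaining factors, and let $\Phi$ be the composition $$R\to R^{ss}\cong\mathbb{F}_2^r\times R_0\to\mathbb{F}_2^r$$ of the quotient map and the projection. Let $\ker(\Phi)$ be its kernel. Then every element of $\ker(\Phi)$ is the sum of two units of $R$. Conversely, an element of $R$ can be written as the sum of two units if and only if it is in $\ker(\Phi)$.
   Context: Rings are finite, unital, with $0\neq 1$, not necessarily commutative. $\mathrm{Rad}(R)$ is the Jacobson radical of $R$. By the Artin–Wedderburn theorem $R^{ss}=R/\mathrm{Rad}(R)$ is isomorphic to a product of matrix rings $M_{n_i}(F_i)$ with $n_i\geq 1$ and $F_i$ a finite field; $r$ is the number of factors with $n_i=1$ and $F_i=\mathbb{F}_2$, and $R_0$ (which has no quotient isomorphic to $\mathbb{F}_2$) is the product of the other factors. $r=0$ is allowed, as is the case where there are no other factors. *)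

(* Defs.v *)
From HB Require Import structures.
From mathcomp Require Import all_boot all_order all_algebra.

Set Implicit Arguments.
Unset Strict Implicit.
Unset Printing Implicit Defensive.

Import GRing.Theory.
Local Open Scope ring_scope.
Local Open Scope quotient_scope.

Section JacobsonRadical.
Variable R : finNzRingType.

Definition left_ideal (I : {set R}) : bool :=
  [&& 0 \in I, [forall x in I, forall y in I, x - y \in I]
    & [forall a, forall x in I, a * x \in I]].

Definition proper_left_ideal (I : {set R}) : bool :=
  left_ideal I && (I != [set: R]).

Definition maximal_left_ideal (M : {set R}) : bool :=
  maxset proper_left_ideal M.

Definition Rad : {pred R} :=
  [pred x | [forall M : {set R}, maximal_left_ideal M ==> (x \in M)]].

Lemma left_idealP (I : {set R}) :
  reflect [/\ 0 \in I, {in I &, forall x y, x - y \in I}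
            & forall a, {in I, forall x, a * x \in I}] (left_ideal I).
Proof.
apply: (iffP and3P) => -[I0 IB IM]; split=> //.
- by move=> x y xI yI; move/forall_inP/(_ x xI)/forall_inP: IB => ->.
- by move=> a x xI; move/forallP/(_ a)/forall_inP: IM => ->.
- by apply/forall_inP=> x xI; apply/forall_inP=> y yI; apply: IB.
- by apply/forallP=> a; apply/forall_inP=> x xI; apply: IM.
Qed.

Lemma RadP x :
  reflect (forall M, maximal_left_ideal M -> x \in M) (x \in Rad).
Proof. exact: 'forall_implyP. Qed.

Lemma maximal_left_ideal_left (M : {set R}) :
  maximal_left_ideal M -> left_ideal M.
Proof. by case/maxsetP=> /andP[]. Qed.

Lemma left_ideal_full (I : {set R}) : left_ideal I -> 1 \in I -> I = [set: R].
Proof.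
move=> /left_idealP[_ _ IM] I1; apply/setP=> x.
by rewrite inE -[x]mulr1 IM.
Qed.

Lemma maximal_left_ideal_exists : exists M : {set R}, maximal_left_ideal M.
Proof.
have P0 : proper_left_ideal [set 0].
  apply/andP; split; last first.
    apply/eqP => /setP/(_ 1); rewrite !inE => /eqP.
    by apply/eqP; rewrite oner_eq0.
  apply/left_idealP; split; rewrite ?inE //.
    by move=> x y /set1P-> /set1P->; rewrite subr0 inE.
  by move=> a x /set1P->; rewrite mulr0 inE.
by have [M maxM _] := maxset_exists P0; exists M.
Qed.

Lemma Rad1 : 1 \notin Rad.
Proof.
apply/negP => /RadP R1; have [M maxM] := maximal_left_ideal_exists.
have /maxsetP[/andP[lM /eqP MT] _] := maxM; case: MT.
by apply: left_ideal_full => //; apply: R1.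
Qed.

Lemma Rad_zmod_closed : zmod_closed Rad.
Proof.
split.
  by apply/RadP => M /maximal_left_ideal_left/left_idealP[].
move=> x y /RadP xR /RadP yR; apply/RadP => M maxM.
have /left_idealP[_ MB _] := maximal_left_ideal_left maxM.
by apply: MB; [apply: xR | apply: yR].
Qed.

HB.instance Definition _ := GRing.isZmodClosed.Build R Rad Rad_zmod_closed.

Lemma RadMl a x : x \in Rad -> a * x \in Rad.
Proof.
move=> /RadP xR; apply/RadP => M maxM.
have /left_idealP[_ _ MM] := maximal_left_ideal_left maxM.
exact/MM/xR.
Qed.

(* The colon ideal [set y | y * a \in M] is maximal unless it is all of R.    *)
Lemma RadMr a x : x \in Rad -> x * a \in Rad.
Proof.
move=> /RadP xR; apply/RadP => M maxM.
have lM := maximal_left_ideal_left maxM.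
have [M0 MB MM] := left_idealP _ lM.
have MD u v : u \in M -> v \in M -> u + v \in M.
  by move=> uM vM; rewrite -[v]opprK -[- v]sub0r; apply/(MB)/MB.
have [aM | aM] := boolP (a \in M); first exact: MM.
pose N := [set y | y * a \in M].
suff /xR : maximal_left_ideal N by rewrite inE.
have lN : left_ideal N.
  apply/left_idealP; split; first by rewrite inE mul0r.
    by move=> y z; rewrite !inE => yN zN; rewrite mulrBl MB.
  by move=> b y; rewrite !inE => yN; rewrite -mulrA MM.
apply/maxsetP; split.
  rewrite /proper_left_ideal lN /=; apply: contraNneq aM => NT.
  by have := in_setT (1 : R); rewrite -NT inE mul1r.
move=> B /andP[lB BT] sNB; apply/eqP; rewrite eqEsubset sNB andbT.
apply/subsetP => b bB; rewrite inE; apply: contraT => baM.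
have [B0 BB BM] := left_idealP _ lB.
pose L := [set z | [exists m in M, exists c, z == m + c * (b * a)]].
have LP z : reflect (exists m c, m \in M /\ z = m + c * (b * a)) (z \in L).
  rewrite inE; apply: (iffP exists_inP) => [[m mM /existsP[c /eqP->]]|].
    by exists m, c.
  by case=> m [c [mM ->]]; exists m => //; apply/existsP; exists c.
have lL : left_ideal L.
  apply/left_idealP; split.
  - by apply/LP; exists 0, 0; rewrite mul0r addr0.
  - move=> _ _ /LP[m [c [mM ->]]] /LP[m' [c' [mM' ->]]].
    apply/LP; exists (m - m'), (c - c'); split; first exact: MB.
    by rewrite mulrBl opprD addrACA.
  - move=> d _ /LP[m [c [mM ->]]]; apply/LP; exists (d * m), (d * c).
    by split; [apply: MM | rewrite mulrDr mulrA].
have sML : M \subset L.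
  by apply/subsetP=> m mM; apply/LP; exists m, 0; rewrite mul0r addr0.
have [LT | LnT] := eqVneq L [set: R]; last first.
  have /maxsetP[_ /(_ L)] := maxM; rewrite /proper_left_ideal lL LnT.
  move=> /(_ isT sML) LM; case/negP: baM; rewrite -LM.
  by apply/LP; exists 0, 1; rewrite mul1r add0r.
have /LP[m [c [mM Da]]] : a \in L by rewrite LT inE.
have cB : 1 - c * b \in B.
  by apply: (subsetP sNB); rewrite inE mulrBl mul1r -mulrA {1}Da addrK.
case/negP: BT; apply/eqP/left_ideal_full => //.
have cbB : - (c * b) \in B by rewrite -sub0r BB // BM.
by have := BB _ _ cB cbB; rewrite opprK subrK.
Qed.

(* ring_quotient only equips quotients of commutative rings with a product,    *)
(* so the product on R / Rad(R) is built here from RadMl and RadMr.            *)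
Definition Rss : Type := {ideal_quot Rad}.

HB.instance Definition _ :=
  EqQuotient.copy Rss {ideal_quot Rad}.
HB.instance Definition _ := Choice.copy Rss {ideal_quot Rad}.
HB.instance Definition _ := GRing.Zmodule.copy Rss {ideal_quot Rad}.
HB.instance Definition _ := ZmodQuotient.copy Rss {ideal_quot Rad}.

Definition Rss_one : Rss := lift_cst Rss 1.
Definition Rss_mul := lift_op2 Rss *%R.

Canonical pi_Rss_one_morph := PiConst Rss_one.

Lemma pi_Rss_eq (x y : R) : (\pi_Rss x == \pi_Rss y) = (x - y \in Rad).
Proof. by rewrite piE. Qed.

Lemma pi_Rss_mul : {morph \pi_Rss : x y / x * y >-> Rss_mul x y}.
Proof.
move=> x y; unlock Rss_mul; apply/eqP; rewrite pi_Rss_eq.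
set x' := repr _; set y' := repr _.
have xx' : x - x' \in Rad by rewrite -pi_Rss_eq /x' reprK.
have yy' : y - y' \in Rad by rewrite -pi_Rss_eq /y' reprK.
rewrite -[x * y](subrK (x * y')) -mulrBr -addrA -mulrBl.
by apply: rpredD; [apply: RadMl | apply: RadMr].
Qed.
Canonical pi_Rss_mul_morph := PiMorph2 pi_Rss_mul.

Lemma Rss_mulA : associative Rss_mul.
Proof. by move=> x y z; rewrite -[x]reprK -[y]reprK -[z]reprK !piE mulrA. Qed.

Lemma Rss_mul1l : left_id Rss_one Rss_mul.
Proof. by move=> x; rewrite -[x]reprK !piE mul1r. Qed.

Lemma Rss_mul1r : right_id Rss_one Rss_mul.
Proof. by move=> x; rewrite -[x]reprK !piE mulr1. Qed.

Lemma Rss_mulDl : left_distributive Rss_mul +%R.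
Proof.
by move=> x y z; rewrite -[x]reprK -[y]reprK -[z]reprK !piE mulrDl.
Qed.

Lemma Rss_mulDr : right_distributive Rss_mul +%R.
Proof.
by move=> x y z; rewrite -[x]reprK -[y]reprK -[z]reprK !piE mulrDr.
Qed.

Lemma Rss_oner_neq0 : Rss_one != 0.
Proof.
have -> : (0 : Rss) = \pi_Rss 0 by rewrite piE.
have -> : Rss_one = \pi_Rss 1 by rewrite piE.
by rewrite pi_Rss_eq subr0 Rad1.
Qed.

HB.instance Definition _ := GRing.Zmodule_isNzRing.Build Rss
  Rss_mulA Rss_mul1l Rss_mul1r Rss_mulDl Rss_mulDr Rss_oner_neq0.

HB.instance Definition _ := @isNzRingQuotient.Build
  R (Quotient.equiv Rad) 0 -%R +%R 1 *%R Rss (lock _) pi_Rss_mul.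

End JacobsonRadical.

Arguments Rad : clear implicits.

Section RingProduct.
Variables (I : finType) (A : I -> pzRingType).

(* An alias, as {dffun _} carries no ring structure in the library. The empty  *)
(* product is the zero ring, hence pzRingType.                                 *)
Definition ring_prod : Type := {dffun forall i, A i}.

HB.instance Definition _ := Choice.on ring_prod.

Implicit Types f g h : ring_prod.

Definition ring_prod_zero : ring_prod := [ffun i => 0 : A i].
Definition ring_prod_opp f : ring_prod := [ffun i => - f i].
Definition ring_prod_add f g : ring_prod := [ffun i => f i + g i].
Definition ring_prod_one : ring_prod := [ffun i => 1 : A i].
Definition ring_prod_mul f g : ring_prod := [ffun i => f i * g i].

Fact ring_prod_addA : associative ring_prod_add.
Proof. by move=> f g h; apply/ffunP=> i; rewrite !ffunE addrA. Qed.
Fact ring_prod_addC : commutative ring_prod_add.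
Proof. by move=> f g; apply/ffunP=> i; rewrite !ffunE addrC. Qed.
Fact ring_prod_add0 : left_id ring_prod_zero ring_prod_add.
Proof. by move=> f; apply/ffunP=> i; rewrite !ffunE add0r. Qed.
Fact ring_prod_addN : left_inverse ring_prod_zero ring_prod_opp ring_prod_add.
Proof. by move=> f; apply/ffunP=> i; rewrite !ffunE addNr. Qed.

HB.instance Definition _ := GRing.isZmodule.Build ring_prod
  ring_prod_addA ring_prod_addC ring_prod_add0 ring_prod_addN.

Fact ring_prod_mulA : associative ring_prod_mul.
Proof. by move=> f g h; apply/ffunP=> i; rewrite !ffunE mulrA. Qed.
Fact ring_prod_mul1l : left_id ring_prod_one ring_prod_mul.
Proof. by move=> f; apply/ffunP=> i; rewrite !ffunE mul1r. Qed.
Fact ring_prod_mul1r : right_id ring_prod_one ring_prod_mul.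
Proof. by move=> f; apply/ffunP=> i; rewrite !ffunE mulr1. Qed.
Fact ring_prod_mulDl : left_distributive ring_prod_mul +%R.
Proof. by move=> f g h; apply/ffunP=> i; rewrite !ffunE mulrDl. Qed.
Fact ring_prod_mulDr : right_distributive ring_prod_mul +%R.
Proof. by move=> f g h; apply/ffunP=> i; rewrite !ffunE mulrDr. Qed.

HB.instance Definition _ := GRing.Zmodule_isPzRing.Build ring_prod
  ring_prod_mulA ring_prod_mul1l ring_prod_mul1r
  ring_prod_mulDl ring_prod_mulDr.

End RingProduct.

Definition ring_isomorphic (A B : pzRingType) : Prop :=
  exists f : {rmorphism A -> B}, bijective f.

(* theta ranges over isomorphisms from Rss R to F_2^r * R0; bijectivity is only *)
(* assumed where it is used.                                                   *)
Section Phi.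
Variables (R : finNzRingType) (r : nat) (R0 : pzRingType).
Variable theta : {rmorphism Rss R -> {ffun 'I_r -> 'F_2} * R0}.

Definition Phi : R -> {ffun 'I_r -> 'F_2} := fst \o theta \o \pi_(Rss R).

HB.instance Definition _ := GRing.RMorphism.on Phi.

Definition ker_Phi : {set R} := [set x | Phi x == 0].

End Phi.

Definition sum_of_two_units (R : unitRingType) (x : R) : Prop :=
  exists u v : R, [/\ u \is a GRing.unit, v \is a GRing.unit & x = u + v].

(* Main.v *)
Require Import Defs.
From HB Require Import structures.
From mathcomp Require Import all_boot all_order all_algebra.
From mathcomp Require Import perm.
Local Open Scope ring_scope.

(** A unit of [R] maps to a unit of [F_2^r], and the only unit of [F_2] is [1],
    so a sum of two units maps to [1 + 1 = 0]: it lies in the kernel.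

    For the converse, units lift along [R -> R / Rad R]: if the class of [a] has
    a left inverse, then no maximal left ideal contains [a], hence [a] has a
    left inverse in [R], and finiteness makes it a unit
    ([unit_of_left_inverse_mod_Rad]).  So it is enough to write the image
    [(0, y)] of an element of the kernel as a sum of two units of the product.
    In [F_2^r], [0 = 1 + (-1)].  What is left is that every matrix [A] in a
    factor [M_n(F)] other than [F_2] is a sum of two invertible matrices
    ([mx_sum_two_units]); the argument depends on the rank [m] of [A].
    - If [m < n], Gaussian elimination makes [A] equivalent to the partial
      identity of rank [m], and a cyclic shift of the rows moves the ones of the
      latter strictly below the diagonal.  So [A] is equivalent to a strictly
      lower triangular [N], and [N = 1 + (N - 1)].
    - If [m = n], [A = A C + A (1 - C)], where [C] is any matrix that has neither
      [0] nor [1] as an eigenvalue.  For [n >= 2] the companion matrix of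
      [X^n - X + 1] will do, as this polynomial takes the value [1] at both [0]
      and [1]; for [n = 1] an element of [F] other than [0] and [1] is needed,
      and it exists because [F] is not [F_2].  *)

Import GRing.Theory.

Lemma fin_left_inverse_unit (R : finUnitRingType) (a c : R) :
  c * a = 1 -> a \is a GRing.unit.
Proof.
move=> ca1.
have injL : injective (fun x => a * x).
  by apply: (can_inj (g := fun x => c * x)) => x; rewrite mulrA ca1 mul1r.
have [g _ gK] := injF_bij injL.
have ag1 : a * g 1 = 1 := gK 1.
apply/unitrP; exists c; split=> //.
have : c * (a * g 1) = g 1 by rewrite mulrA ca1 mul1r.
by rewrite ag1 mulr1 => ->.
Qed.

(** If [R a] were proper it would lie in a maximal left ideal [M]; then [M]
    contains [b * a] and the radical element [b * a - 1], hence [1]. *)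
Lemma unit_of_left_inverse_mod_Rad (R : finUnitRingType) (a b : R) :
  b * a - 1 \in Rad R -> a \is a GRing.unit.
Proof.
move=> /RadP ba1.
pose I := [set x * a | x : R].
have lI : left_ideal I.
  apply/left_idealP; split.
  - by apply/imsetP; exists 0; rewrite ?mul0r.
  - move=> _ _ /imsetP[x _ ->] /imsetP[y _ ->].
    by apply/imsetP; exists (x - y); rewrite ?mulrBl.
  - move=> c _ /imsetP[x _ ->].
    by apply/imsetP; exists (c * x); rewrite ?mulrA.
have [IT | IT] := eqVneq I [set: R].
  have /imsetP[c _ /esym ca1] : 1 \in I by rewrite IT inE.
  exact: fin_left_inverse_unit ca1.
have pI : proper_left_ideal I by rewrite /proper_left_ideal lI.
have [M maxM sIM] := maxset_exists pI.
have /maxsetP[/andP[lM /eqP MT] _] := maxM; case: MT.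
apply: left_ideal_full => //.
have /left_idealP[_ MB _] := lM.
have baM : b * a \in M by apply: (subsetP sIM); apply: imset_f.
by rewrite -[1](subKr (b * a)) MB // ba1.
Qed.

(** [N - 1] is triangular with [-1] on the diagonal. *)
Lemma strict_trig_sub1_unit (F : fieldType) (n : nat) (N : 'M[F]_n) :
  (forall i j : 'I_n, (i <= j)%N -> N i j = 0) -> N - 1%:M \in unitmx.
Proof.
move=> N0; rewrite unitmxE det_trig; last first.
  apply/is_trig_mxP => i j ij; rewrite !mxE N0 1?ltnW // sub0r.
  by rewrite -val_eqE (ltn_eqF ij) oppr0.
rewrite unitfE; apply/prodf_neq0 => i _.
by rewrite !mxE N0 // eqxx sub0r oppr_eq0 oner_eq0.
Qed.

(** Rank deficiency is what lets the partial identity be made nilpotent: its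
    last row is zero, so the cyclic shift that sends it to the top puts all the
    ones strictly below the diagonal. *)
Lemma singular_mx_sum_two_units (F : fieldType) (n : nat) (A : 'M[F]_n) :
  (\rank A < n)%N ->
  exists U V : 'M[F]_n, [/\ U \in unitmx, V \in unitmx & A = U + V].
Proof.
move=> rA; pose s := perm (@ord_pred_inj n).
pose N : 'M[F]_n := row_perm s (pid_mx (\rank A)).
have N0 (i j : 'I_n) : (i <= j)%N -> N i j = 0.
  move=> ij; rewrite !mxE permE /=.
  (* Row i of N is row i - 1 of the partial identity; for i = 0 this is row
     n - 1, which is zero since the rank is less than n. *)
  case: eqP => [Dj|//]; case: ltnP => [|//].
  case: n i j ij Dj {s N} A rA => [[]//|n] i j.
  case: i => -[|i] ltin /= ij Dj A rA.
    by rewrite modn_small // => /leq_trans/(_ rA); rewrite ltnn.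
  by move: ij; rewrite -Dj modnDr modn_small ?ltnn // ltnW.
have DA : A = (col_ebase A *m perm_mx s^-1) *m N *m row_ebase A.
  rewrite /N row_permE !mulmxA -[col_ebase A *m _ *m _]mulmxA -perm_mxM.
  by rewrite mulVg perm_mx1 mulmx1 mulmx_ebase.
set P := _ *m perm_mx _ in DA; set Q := row_ebase A in DA.
have Pu : P \in unitmx by rewrite unitmx_mul col_ebase_unit unitmx_perm.
have Qu : Q \in unitmx := row_ebase_unit A.
exists (P *m Q), (P *m (N - 1%:M) *m Q); split.
- by rewrite unitmx_mul; apply/andP.
- rewrite unitmx_mul; apply/andP; split=> //.
  rewrite unitmx_mul; apply/andP; split=> //.
  exact: strict_trig_sub1_unit.
- by rewrite mulmxBr mulmx1 mulmxBl -DA addrC subrK.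
Qed.

(** For [n >= 2], [X^n - X + 1] is monic of degree [n] and its values at [0] and
    [1] are both [1], whatever the characteristic; so neither is an eigenvalue
    of its companion matrix. *)
Lemma exists_mx_avoiding_0_1 (F : fieldType) (n : nat) : (1 < n)%N ->
  exists C : 'M[F]_n, C \in unitmx /\ 1%:M - C \in unitmx.
Proof.
move=> n_gt1; pose p : {poly F} := 'X^n - ('X - 1%:P).
have szX1 : (size (- ('X - 1%:P : {poly F})) < size ('X^n : {poly F}))%N.
  by rewrite size_polyN size_XsubC size_polyXn.
have Dn : (size p).-1 = n by rewrite /p size_polyDl // size_polyXn.
have mp : p \is monic by rewrite monicE /p lead_coefDl // lead_coefXn.
have p0 : p.[0] = 1.
  by rewrite /p !hornerE expr0n (gtn_eqF (ltnW n_gt1)) !sub0r opprK.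
have p1 : p.[1] = 1 by rewrite /p !hornerE expr1n subrr subr0.
clearbody p; rewrite -{n n_gt1 szX1}Dn; exists (companionmx p).
have unit_sub a : p.[a] = 1 -> companionmx p - a%:M \in unitmx.
  move=> pa; rewrite -row_free_unit -kermx_eq0 -[_ == 0]negbK.
  rewrite -[_ != 0]/(eigenvalue _ a) eigenvalue_root_char companionmxK //.
  by rewrite /root pa oner_eq0.
split; first by have := unit_sub 0 p0; rewrite raddf0 subr0.
by rewrite -opprB -scaleN1r unitmxZ ?unit_sub // unitrN1.
Qed.

Lemma invertible_mx_sum_two_units (F : fieldType) (n : nat) (A : 'M[F]_n) :
  A \in unitmx ->
  (exists C : 'M[F]_n, C \in unitmx /\ 1%:M - C \in unitmx) ->
  exists U V : 'M[F]_n, [/\ U \in unitmx, V \in unitmx & A = U + V].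
Proof.
move=> Au [C [Cu C1u]]; exists (A *m C), (A *m (1%:M - C)).
by rewrite !unitmx_mul Au Cu C1u mulmxBr mulmx1 addrC subrK.
Qed.

(** If [0] and [1] are the only elements of [F], sending [0] to [0] and [1] to
    [1] is an isomorphism from [F = M_1(F)] to [F_2]. *)
Lemma exists_scalar_avoiding_0_1 (F : finFieldType) :
  ~ ring_isomorphic 'M[F]_1 'F_2 -> exists c : F, c != 0 /\ 1 - c != 0.
Proof.
move=> notF2; have [/existsP[c /andP[]] | noc] :=
  boolP [exists c : F, (c != 0) && (1 - c != 0)]; first by exists c.
have F01 (c : F) : c = 0 \/ c = 1.
  move: noc; rewrite negb_exists => /forallP/(_ c).
  rewrite negb_and !negbK => /orP[/eqP-> | ]; first by left.
  by rewrite subr_eq0 => /eqP <-; right.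
case: notF2.
have nz1 : (1 : F) == 0 = false := oner_eq0 F.
have add11 : 1 + 1 = 0 :> F.
  have [//|/eqP] := F01 (1 + 1).
  by rewrite -subr_eq0 addrK nz1.
pose f (A : 'M[F]_1) : 'F_2 := (A 0 0 != 0)%:R.
have fB : GRing.nmod_morphism f.
  split=> [|A B]; rewrite /f !mxE ?eqxx //.
  case: (F01 (A 0 0)) => ->; case: (F01 (B 0 0)) => ->;
    by rewrite ?addr0 ?add0r ?add11 ?eqxx ?nz1 //; apply/val_inj.
have fM : GRing.monoid_morphism f.
  split=> [|A B]; first by rewrite /f !mxE nz1.
  rewrite /f mxE big_ord1.
  case: (F01 (A 0 0)) => ->; case: (F01 (B 0 0)) => ->;
    by rewrite ?mul0r ?mulr0 ?mulr1 ?eqxx ?nz1 //; apply/val_inj.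
pose fA := GRing.isNmodMorphism.Build 'M[F]_1 'F_2 f fB.
pose fMM := GRing.isMonoidMorphism.Build 'M[F]_1 'F_2 f fM.
pose fR : {rmorphism 'M[F]_1 -> 'F_2} := HB.pack f fA fMM.
exists fR; exists (fun a : 'F_2 => (a != 0)%:R%:M) => [A|a] /=.
  rewrite [RHS]mx11_scalar /f; case: (F01 (A 0 0)) => ->; rewrite ?eqxx ?nz1 //.
rewrite /f mxE eqxx; case: a => [[|[|//]] ?]; apply/val_inj;
  by rewrite /= ?eqxx ?nz1.
Qed.

Lemma mx_sum_two_units (F : finFieldType) (n : nat) :
  (0 < n)%N -> ~ ring_isomorphic 'M[F]_n 'F_2 ->
  forall A : 'M[F]_n,
    exists U V : 'M[F]_n, [/\ U \in unitmx, V \in unitmx & A = U + V].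
Proof.
move=> n_gt0 notF2 A.
have := rank_leq_row A; rewrite leq_eqVlt => /orP[fullA|]; last first.
  exact: singular_mx_sum_two_units.
apply: invertible_mx_sum_two_units; first by rewrite -row_free_unit.
case: (ltngtP n 1) => [||n1]; first by rewrite ltnNge n_gt0.
  exact: exists_mx_avoiding_0_1.
subst n; have [c [c0 c1]] := exists_scalar_avoiding_0_1 F notF2.
by exists c%:M; rewrite -raddfB !unitmxE !det_scalar !expr1 !unitfE.
Qed.

Lemma F2_left_unit_eq1 (a b : 'F_2) : b * a = 1 -> a = 1.
Proof. by case: a b => [[|[|//]] ?] [[|[|//]] ?] // _; apply/val_inj. Qed.

Theorem proposition2p10 (R : finUnitRingType) (r k : nat)
    (n : 'I_k -> nat) (F : 'I_k -> finFieldType)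
    (n_gt0 : forall i, (0 < n i)%N)
    (factor_not_F2 : forall i, ~ ring_isomorphic 'M[F i]_(n i) 'F_2)
    (theta : {rmorphism Rss R ->
                {ffun 'I_r -> 'F_2} * ring_prod (fun i => 'M[F i]_(n i))})
    (theta_bij : bijective theta) :
  (forall x : R, x \in ker_Phi theta -> sum_of_two_units x) /\
  (forall x : R, sum_of_two_units x <-> x \in ker_Phi theta).
Proof.
pose P := ({ffun 'I_r -> 'F_2} * ring_prod (fun i => 'M[F i]_(n i)))%type.
pose q (x : R) : P := theta (\pi_(Rss R)%qT x).
have Phi_unit (u : R) : u \is a GRing.unit -> Phi theta u = 1.
  move=> /mulVr/(congr1 (Phi theta)); rewrite rmorphM rmorph1 => uV1.
  apply/ffunP => i; rewrite ffunE; apply: (F2_left_unit_eq1 _ (Phi theta u^-1 i)).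
  by move/ffunP/(_ i): uV1; rewrite !ffunE.
have q_surj (y : P) : exists a, q a = y.
  have [g _ gK] := theta_bij.
  by exists (repr (g y)); rewrite /q reprK.
have lift_unit (x : R) (y : P) : y * q x = 1 -> x \is a GRing.unit.
  have [z <-] := q_surj y; rewrite /q -rmorphM -rmorphM => zx1.
  apply: (unit_of_left_inverse_mod_Rad _ _ z); rewrite -pi_Rss_eq.
  apply/eqP; apply: (bij_inj theta_bij); rewrite zx1 -[LHS](rmorph1 theta).
  by congr (theta _); apply/esym/rmorph1.
have ker_sum (x : R) : x \in ker_Phi theta -> sum_of_two_units x.
  rewrite inE => /eqP qx1.
  have dec i : exists W : 'M[F i]_(n i) * 'M[F i]_(n i),
      [/\ W.1 \in unitmx, W.2 \in unitmx & (q x).2 i = W.1 + W.2].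
    have [U [V UVP]] :=
      mx_sum_two_units _ _ (n_gt0 i) (factor_not_F2 i) ((q x).2 i).
    by exists (U, V).
  have [W WP] := fin_all_exists dec.
  have [u qu] := q_surj (1, [ffun i => (W i).1]).
  exists u, (x - u); split; last by rewrite addrC subrK.
    apply: (lift_unit _ (1, [ffun i => invmx (W i).1])); rewrite qu.
    congr (_, _); first exact: mulr1.
    apply/ffunP => i; rewrite !ffunE; case: (WP i) => W1u _ _.
    exact: mulVmx.
  (* On F_2^r the difference x - u is 0 - 1, its own inverse. *)
  apply: (lift_unit _ (-1, [ffun i => invmx (W i).2])).
  have -> : q (x - u) = q x - q u by rewrite /q !rmorphB.
  rewrite qu; congr (_, _) => /=.
    by rewrite -[(q x).1]/(Phi theta x) qx1 sub0r mulrNN mulr1.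
  apply/ffunP => i; rewrite !ffunE; case: (WP i) => _ W2u ->.
  by rewrite [X in X - _]addrC addrK; apply: mulVmx.
split=> // x; split=> [[u [v [uu uv ->]]]|]; last exact: ker_sum.
have PhiD : Phi theta (u + v) = Phi theta u + Phi theta v by exact: rmorphD.
rewrite inE PhiD !Phi_unit //.
by apply/eqP/ffunP => i; rewrite !ffunE; apply/val_inj.
Qed.
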